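(* Consider an instance of the Multiple Drone-Delivery Scheduling Problem (MDSP) with $m$ drones of battery capacity $B$ and $n$ jobs, and let $\Delta$ be the maximum, over all jobs $j$, of the number of other jobs whose intervals intersect $I_j$. Assume $\Delta\le m$. Then the Modified Greedy Algorithm described in the context is a $\frac{1}{3}$-approximation algorithm: it outputs $m$ pairwise disjoint, compatible, feasible assignments whose total reward is at least $\frac{1}{3}\,OPT$.
   Context: MDSP instance: there are $m$ identical drones, each with energy budget (battery) $B \ge 0$, and $n$ jobs (deliveries) $j=1,\dots,n$. Job $j$ has an open time interval $I_j=(t^L_j,t^R_j)$, an energy cost $c_j$ with $0\le c_j\le B$, and a reward $p_j\ge 0$. Two jobs $a,b$ conflict if $I_a\cap I_b\neq\varnothing$. An assignment is a set $S_i$ of jobs given to drone $i$; it is compatible if no two of its jobs conflict, and feasible if $\mathcal{W}(S_i)=\sum_{j\in S_i}c_j\le B$. Its reward is $\mathcal{P}(S_i)=\sum_{j\in S_i}p_j$, and the reward of a family of assignments is the sum of the rewards of its members. $OPT$ is the maximum of $\sum_{i=1}^m\mathcal{P}(S_i)$ over all families $(S_1,\dots,S_m)$ of pairwise disjoint, compatible, feasible assignments. The density of job $j$ is $d_j=p_j/c_j$ (taken as $+\infty$ if $c_j=0$). Modified Greedy Algorithm (uses $2m+\Delta$ drones, all initially with empty assignments): Step 1. Order the jobs so that $d_1\ge d_2\ge\dots\ge d_n$. Let $C=\varnothing$ be the set of critically-assigned drones. Step 2. For $j=1,\dots,n$: if $|C|\ge m$, stop this loop. Otherwise choose a drone $i\in\{1,\dots,m+\Delta\}\setminus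 C$ whose current assignment $S_i$ contains no job conflicting with $j$, and add $j$ to $S_i$; if now $\mathcal{W}(S_i)>B$, add $i$ to $C$ and set $L_i=j$. Step 3 (correction). Enumerate the critical drones as $i_1,\dots,i_{|C|}$. For the $k$-th critical drone $i=i_k$: if $\mathcal{P}(S_i\setminus\{L_i\})\ge p_{L_i}$, set $S_{m+\Delta+k}=\{L_i\}$ and $S_i=S_i\setminus\{L_i\}$; otherwise set $S_{m+\Delta+k}=S_i\setminus\{L_i\}$ and $S_i=\{L_i\}$. Step 4. Output the $m$ assignments of largest reward among the $2m+\Delta$ drones. *)

(* Defs.v *)
From HB Require Import structures.
From mathcomp Require Import all_boot all_order all_algebra.
From mathcomp Require Import boolp classical_sets set_interval reals ereal.

Set Implicit Arguments.
Unset Strict Implicit.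
Unset Printing Implicit Defensive.

Import Order.TTheory GRing.Theory Num.Theory.
Local Open Scope ring_scope.

(* Jobs and drones are numbered from 0: job j is an element of 'I_n, and a
   family of assignments to k drones is an element of 'I_k -> {set 'I_n}. *)

Record mdsp (R : realType) (m n : nat) := Mdsp {
  battery : R;
  tstart : 'I_n -> R;
  tend : 'I_n -> R;
  cost : 'I_n -> R;
  reward : 'I_n -> R;
  battery_ge0 : 0 <= battery;
  cost_ge0 : forall j, 0 <= cost j;
  cost_le_battery : forall j, cost j <= battery;
  reward_ge0 : forall j, 0 <= reward j
}.

Definition job_interval (R : realType) (m n : nat) (I : mdsp R m n) (j : 'I_n) :
    set R :=
  `]tstart I j, tend I j[%classic.

(* [tstart I j < tend I j] is not required: a job whose interval is empty
   conflicts with no job. *)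
Definition conflict (R : realType) (m n : nat) (I : mdsp R m n)
    (a b : 'I_n) : bool :=
  `[< (job_interval I a `&` job_interval I b !=set0)%classic >].

Definition max_conflicts (R : realType) (m n : nat) (I : mdsp R m n) : nat :=
  (\max_(j < n) #|[set k : 'I_n | (k != j) && conflict I j k]|)%N.

Definition weight (R : realType) (m n : nat) (I : mdsp R m n)
    (A : {set 'I_n}) : R :=
  \sum_(j in A) cost I j.

Definition profit (R : realType) (m n : nat) (I : mdsp R m n)
    (A : {set 'I_n}) : R :=
  \sum_(j in A) reward I j.

Definition compatible (R : realType) (m n : nat) (I : mdsp R m n)
    (A : {set 'I_n}) : bool :=
  [forall a in A, forall b in A, (a != b) ==> ~~ conflict I a b].

Definition feasible (R : realType) (m n : nat) (I : mdsp R m n)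
    (A : {set 'I_n}) : bool :=
  weight I A <= battery I.

Definition pairwise_disjoint (k n : nat) (S : {ffun 'I_k -> {set 'I_n}}) :
    bool :=
  [forall i, forall l, (i != l) ==> [disjoint S i & S l]].

Definition solution (R : realType) (m n : nat) (I : mdsp R m n)
    (S : {ffun 'I_m -> {set 'I_n}}) : bool :=
  pairwise_disjoint S && [forall i, compatible I (S i) && feasible I (S i)].

Definition total_profit (R : realType) (m n : nat) (I : mdsp R m n) (k : nat)
    (S : {ffun 'I_k -> {set 'I_n}}) : R :=
  \sum_(i < k) profit I (S i).

(* The family of empty assignments is a solution of total profit 0 and all
   profits are nonnegative, so the default value 0 does not alter the maximum. *)
Definition OPT (R : realType) (m n : nat) (I : mdsp R m n) : R :=
  \big[Num.max/0]_(S : {ffun 'I_m -> {set 'I_n}} | solution I S)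
     total_profit I S.

Definition density (R : realType) (m n : nat) (I : mdsp R m n) (j : 'I_n) :
    \bar R :=
  if cost I j == 0 then +oo%E else (reward I j / cost I j)%:E.

(* The Modified Greedy Algorithm leaves several choices open (ties between
   densities, the drone receiving a job, the enumeration of the critical drones,
   ties between rewards in the output), so it is modelled by the relation
   [mga I o]: "some execution on I ends with outcome o".  The outcome is [None]
   when the execution gets stuck because no drone can receive the current job,
   and [Some T] when it outputs the family T.

   The drones 1, ..., 2m+Delta are the elements 0, ..., 2m+Delta-1 of the
   type 'I_(num_drones I); those used in Step 2 are the elements below
   m+Delta, where Delta is [max_conflicts I]. *)
Definition num_drones (R : realType) (m n : nat) (I : mdsp R m n) : nat :=
  (2 * m + max_conflicts I)%N.

(* [critical] is C, and [last_job i] is [Some j] once L_i has been set to j. *)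
Record state (R : realType) (m n : nat) (I : mdsp R m n) := State {
  assigned : {ffun 'I_(num_drones I) -> {set 'I_n}};
  critical : {set 'I_(num_drones I)};
  last_job : {ffun 'I_(num_drones I) -> option 'I_n}
}.

Definition init_state (R : realType) (m n : nat) (I : mdsp R m n) : state I :=
  @State R m n I [ffun=> finset.set0] finset.set0 [ffun=> None].

Definition eligible (R : realType) (m n : nat) (I : mdsp R m n)
    (st : state I) (j : 'I_n) (i : 'I_(num_drones I)) : bool :=
  [&& (i < m + max_conflicts I)%N, i \notin critical st
    & [forall a in assigned st i, ~~ conflict I a j]].

Definition place (R : realType) (m n : nat) (I : mdsp R m n)
    (st : state I) (j : 'I_n) (i : 'I_(num_drones I)) : state I :=
  let A := j |: assigned st i in
  let S := [ffun d => if d == i then A else assigned st d] in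
  if battery I < weight I A then
    @State R m n I S (i |: critical st)
      [ffun d => if d == i then Some j else last_job st d]
  else @State R m n I S (critical st) (last_job st).

(* [greedy s st o]: the loop of Step 2, run from state st on the remaining jobs
   s (in this order), can end with outcome o. *)
Inductive greedy (R : realType) (m n : nat) (I : mdsp R m n) :
    seq 'I_n -> state I -> option (state I) -> Prop :=
| greedy_nil st : greedy [::] st (Some st)
| greedy_stop j s st : (m <= #|critical st|)%N -> greedy (j :: s) st (Some st)
| greedy_place j s st i o : (#|critical st| < m)%N -> eligible st j i ->
    greedy s (place st j i) o -> greedy (j :: s) st o
| greedy_stuck j s st : (#|critical st| < m)%N ->
    (forall i, ~~ eligible st j i) -> greedy (j :: s) st None.

Definition last_set (R : realType) (m n : nat) (I : mdsp R m n)
    (st : state I) (i : 'I_(num_drones I)) : {set 'I_n} :=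
  [set j | last_job st i == Some j].

(* The two parts of the assignment of a critical drone i in Step 3: the first
   one is kept by i, the second one moves to a new drone. *)
Definition split_critical (R : realType) (m n : nat) (I : mdsp R m n)
    (st : state I) (i : 'I_(num_drones I)) : {set 'I_n} * {set 'I_n} :=
  let L := last_set st i in
  let A := assigned st i :\: L in
  if profit I L <= profit I A then (A, L) else (L, A).

(* Step 3 for the enumeration e of the critical drones.  The critical drones
   are below m+Delta, hence distinct from the new drones m+Delta+k, and the
   corrections do not interfere with each other. *)
Definition correction (R : realType) (m n : nat) (I : mdsp R m n)
    (st : state I) (e : seq 'I_(num_drones I)) :
    {ffun 'I_(num_drones I) -> {set 'I_n}} :=
  [ffun d : 'I_(num_drones I) =>
    let k := (d - (m + max_conflicts I))%N in
    if d \in e then (split_critical st d).1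
    else if (m + max_conflicts I <= d)%N && (k < size e)%N then
      (split_critical st (nth d e k)).2
    else assigned st d].

(* T lists, for m distinct drones, m assignments of largest reward in S. *)
Definition best_of (R : realType) (m n : nat) (I : mdsp R m n)
    (S : {ffun 'I_(num_drones I) -> {set 'I_n}})
    (T : {ffun 'I_m -> {set 'I_n}}) : Prop :=
  exists f : 'I_m -> 'I_(num_drones I),
    [/\ injective f,
        forall i, T i = S (f i)
      & forall i d, (forall l, f l != d) ->
          profit I (S d) <= profit I (S (f i))].

Definition density_order (R : realType) (m n : nat) (I : mdsp R m n)
    (s : seq 'I_n) : Prop :=
  perm_eq s (enum 'I_n) /\
  sorted (fun a b => (density I b <= density I a)%E) s.

Inductive mga (R : realType) (m n : nat) (I : mdsp R m n) :
    option {ffun 'I_m -> {set 'I_n}} -> Prop :=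
| mga_stuck s : density_order I s ->
    greedy s (init_state I) None -> mga I None
| mga_output s st e T : density_order I s ->
    greedy s (init_state I) (Some st) ->
    perm_eq e (enum (critical st)) ->
    best_of (correction st e) T -> mga I (Some T).

(* Main.v *)
Require Import Defs.
From mathcomp Require Import all_boot all_order all_algebra.
From mathcomp Require Import reals.
From mathcomp Require Import ereal zify lra.

Set Implicit Arguments.
Unset Strict Implicit.
Unset Printing Implicit Defensive.

Import Order.TTheory GRing.Theory Num.Theory.
Local Open Scope ring_scope.

(** If fewer than [m] drones are critical, more than [max_conflicts I] drones
among the first [m + max_conflicts I] are available, and a job conflicts with at
most [max_conflicts I] others: the greedy loop never gets stuck.  It therefore
assigns a prefix of the density order which is either the set of all jobs or has
weight more than [m] batteries; by the fractional knapsack argument the profit of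
the prefix is at least [OPT I].  Splitting the critical assignments distributes
this profit over [2 * m + max_conflicts I <= 3 * m] disjoint feasible assignments,
so the [m] best ones collect a third of it. *)

(** * Compatibility of assignments and sums over families of sets *)

Lemma conflict_sym (R : realType) (m n : nat) (I : mdsp R m n) (a b : 'I_n) :
  conflict I a b = conflict I b a.
Proof. by rewrite /conflict classical_sets.setIC. Qed.

Lemma compatibleP (R : realType) (m n : nat) (I : mdsp R m n)
    (A : {set 'I_n}) :
  reflect (forall a b, a \in A -> b \in A -> a != b -> ~~ conflict I a b)
    (compatible I A).
Proof.
apply: (iffP forall_inP) => [H a b aA bA ab|H a aA].
  by have /forall_inP/(_ b bA)/implyP/(_ ab) := H a aA.
by apply/forall_inP => b bA; apply/implyP => ab; exact: H.
Qed.

Lemma compatible_sub (R : realType) (m n : nat) (I : mdsp R m n)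
    (A A' : {set 'I_n}) :
  A \subset A' -> compatible I A' -> compatible I A.
Proof.
move=> /subsetP sAA' /compatibleP H; apply/compatibleP => a b aA bA.
by apply: H; exact: sAA'.
Qed.

Lemma compatible_setU1 (R : realType) (m n : nat) (I : mdsp R m n)
    (A : {set 'I_n}) (j : 'I_n) :
  (forall a, a \in A -> ~~ conflict I a j) -> compatible I A ->
  compatible I (j |: A).
Proof.
move=> Hj /compatibleP H; apply/compatibleP => a b.
rewrite !inE => /orP[/eqP->|aA] /orP[/eqP->|bA] ab.
- by rewrite eqxx in ab.
- by rewrite conflict_sym Hj.
- exact: Hj.
- exact: H.
Qed.

Lemma sum_disjoint_bigcup (R : realType) (n : nat) (T : finType)
    (A : pred T) (S : T -> {set 'I_n}) (g : 'I_n -> R) :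
  (forall i k x, x \in S i -> x \in S k -> i = k) ->
  \sum_(j in \bigcup_(i in A) S i) g j = \sum_(i in A) \sum_(j in S i) g j.
Proof.
move=> disjS.
rewrite (exchange_big_dep (fun j => j \in \bigcup_(i in A) S i)) /=; last first.
  by move=> i j iA jS; apply/bigcupP; exists i.
apply: eq_bigr => j /bigcupP[i iA jS].
rewrite (bigD1 i) /=; last by rewrite iA jS.
rewrite big1 ?addr0// => k /andP[/andP[_ jk]].
by rewrite (disjS _ _ _ jk jS) eqxx.
Qed.

Lemma ler_sum_subset (R : realType) (n : nat) (g : 'I_n -> R)
    (A A' : {set 'I_n}) :
  (forall j, 0 <= g j) -> A \subset A' ->
  \sum_(j in A) g j <= \sum_(j in A') g j.
Proof.
move=> g0 sAA'; rewrite [leRHS](big_setID A) (setIidPr sAA') lerDl.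
exact: sumr_ge0.
Qed.

(** With the sum over jobs taken outermost, the right side counts each job of [P] at least once, and
    every other contribution is nonnegative. *)
Lemma profit_le_cover (R : realType) (m n : nat) (I : mdsp R m n) (k : nat)
    (S : {ffun 'I_k -> {set 'I_n}}) (P : {set 'I_n}) :
  (forall x, x \in P -> exists i, x \in S i) ->
  profit I P <= total_profit I S.
Proof.
move=> covS; rewrite /total_profit /profit.
rewrite (exchange_big_dep predT) //= [leLHS]big_mkcond.
apply: ler_sum => j _; case: ifP => [/covS[i jS]|_].
  rewrite (bigD1 i) //= lerDl; apply: sumr_ge0 => *; exact: reward_ge0.
by apply: sumr_ge0 => *; exact: reward_ge0.
Qed.

(** * The invariant of the greedy loop and its outcome *)

(** [P] is the set of jobs placed so far. [inv_critical] serves twice: the overflow bounds the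
    weight of [P] from below, and feasibility without the last job makes both parts of the later
    split feasible. [inv_range] keeps the drones from [m + max_conflicts I] on empty, so that parts
    moved there overwrite nothing. *)
Record greedy_inv (R : realType) (m n : nat) (I : mdsp R m n)
    (P : {set 'I_n}) (st : state I) : Prop := GreedyInv {
  inv_disjoint : forall i k x,
    x \in assigned st i -> x \in assigned st k -> i = k;
  inv_cover : forall x, x \in P <-> exists i, x \in assigned st i;
  inv_compatible : forall i, compatible I (assigned st i);
  inv_feasible : forall i, i \notin critical st -> feasible I (assigned st i);
  inv_critical : forall i, i \in critical st -> exists l,
    [/\ last_set st i = [set l], l \in assigned st i,
        battery I < weight I (assigned st i)
      & feasible I (assigned st i :\ l)];
  inv_range : forall i x, x \in assigned st i -> (i < m + max_conflicts I)%N;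
  inv_card : (#|critical st| <= m)%N
}.

Lemma greedy_inv_init (R : realType) (m n : nat) (I : mdsp R m n) :
  greedy_inv set0 (init_state I).
Proof.
split => /=.
- by move=> i k x; rewrite ffunE inE.
- by move=> x; split=> [|[i]]; rewrite ?ffunE inE.
- by move=> i; apply/compatibleP => a b; rewrite ffunE inE.
- by move=> i _; rewrite ffunE /feasible /weight big_set0 battery_ge0.
- by move=> i; rewrite inE.
- by move=> i x; rewrite ffunE inE.
- by rewrite cards0.
Qed.

Lemma assigned_place (R : realType) (m n : nat) (I : mdsp R m n)
    (st : state I) (j : 'I_n) (i d : 'I_(num_drones I)) :
  assigned (place st j i) d =
  if d == i then j |: assigned st d else assigned st d.
Proof.
by rewrite /place; case: ifP => _ /=; rewrite ffunE; case: eqP => // ->.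
Qed.

Lemma in_critical_place (R : realType) (m n : nat) (I : mdsp R m n)
    (st : state I) (j : 'I_n) (i d : 'I_(num_drones I)) :
  (d \in critical (place st j i)) =
  (d \in critical st) ||
  (d == i) && (battery I < weight I (j |: assigned st i)).
Proof.
by rewrite /place; case: ifP => _ /=; rewrite ?in_setU1 ?andbT ?andbF ?orbF // orbC.
Qed.

Lemma last_set_place (R : realType) (m n : nat) (I : mdsp R m n)
    (st : state I) (j : 'I_n) (i d : 'I_(num_drones I)) :
  last_set (place st j i) d =
  if (d == i) && (battery I < weight I (j |: assigned st i)) then [set j]
  else last_set st d.
Proof.
apply/setP => x; rewrite /last_set /place; case: ifP => _ /=.
  by rewrite andbT inE ffunE; case: (d =P i) => _; rewrite !inE // eq_sym.
by rewrite andbF inE.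
Qed.

Lemma card_critical_place (R : realType) (m n : nat) (I : mdsp R m n)
    (st : state I) (j : 'I_n) (i : 'I_(num_drones I)) :
  (#|critical (place st j i)| <= #|critical st|.+1)%N.
Proof.
rewrite /place; case: ifP => _ //=.
by rewrite cardsU1 -add1n leq_add2r leq_b1.
Qed.

Lemma greedy_inv_place (R : realType) (m n : nat) (I : mdsp R m n)
    (P : {set 'I_n}) (st : state I) (j : 'I_n) (i : 'I_(num_drones I)) :
  greedy_inv P st -> j \notin P -> (#|critical st| < m)%N ->
  eligible st j i -> greedy_inv (j |: P) (place st j i).
Proof.
move=> [dS cov comp feas crit rng card] jP ltm /and3P[im iC /forall_inP nconf].
have jS d : j \notin assigned st d.
  by apply: contra jP => jd; apply/cov; exists d.
have inP d x : x \in assigned (place st j i) d ->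
    x = j /\ d = i \/ x \in assigned st d.
  rewrite assigned_place; case: eqP => [->|_]; last by right.
  by rewrite !inE => /orP[/eqP->|]; [left|right].
split.
- move=> d k x /inP[[-> ->]|xd] /inP[[xj ->]|xk] //.
  + by rewrite (negPf (jS k)) in xk.
  + by move: xd; rewrite xj (negPf (jS d)).
  + exact: (dS _ _ x).
- move=> x; split=> [|[d /inP[[-> _]|xd]]].
  + rewrite !inE => /orP[/eqP->|/cov[d xd]].
      by exists i; rewrite assigned_place eqxx !inE eqxx.
    by exists d; rewrite assigned_place; case: ifP; rewrite ?inE xd ?orbT.
  + by rewrite !inE eqxx.
  + by rewrite !inE; apply/orP; right; apply/cov; exists d.
- move=> d; rewrite assigned_place; case: eqP => // ->.
  exact: compatible_setU1.
- move=> d; rewrite in_critical_place assigned_place negb_or => /andP[dC].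
  case: eqP => [->|_ _]; last exact: feas.
  by rewrite /= -leNgt.
- move=> d; rewrite in_critical_place last_set_place assigned_place.
  case: (altP (d =P i)) => [->|_] /=; last by rewrite orbF; exact: crit.
  rewrite (negPf iC) /= => Wj; rewrite Wj; exists j; split=> //.
    by rewrite !inE eqxx.
  (* Removing [j] gives back the previous assignment, feasible because [i] was not yet critical. *)
  by rewrite setU1K ?jS //; exact: feas.
- by move=> d x /inP[[_ ->]//|]; exact: rng.
- exact: leq_trans (card_critical_place _ _ _) ltm.
Qed.

(* Each drone barred for [j] holds its own job conflicting with [j], so at most
   [max_conflicts I] of the noncritical drones are barred. *)
Lemma exists_eligible (R : realType) (m n : nat) (I : mdsp R m n)
    (P : {set 'I_n}) (st : state I) (j : 'I_n) :
  greedy_inv P st -> j \notin P -> (#|critical st| < m)%N ->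
  exists i, eligible st j i.
Proof.
move=> [dS cov comp feas crit rng card] jP ltm.
apply/existsP; rewrite -[X in is_true X]negbK negb_exists; apply/negP => /forallP none.
set D := max_conflicts I.
pose low := [set d : 'I_(num_drones I) | (d < m + D)%N].
have cardlow : #|low| = (m + D)%N.
  have le : (m + D <= num_drones I)%N by rewrite /num_drones leq_add2r mul2n -addnn leq_addr.
  rewrite -[RHS]card_ord -(card_imset _ (f := widen_ord le)); last first.
    by move=> a b /(congr1 val) /= ab; exact: val_inj.
  apply: eq_card => d; rewrite inE; apply/idP/imsetP => [dl|[a _ ->]/=].
    by exists (Ordinal dl) => //; exact: val_inj.
  exact: ltn_ord.
pose K := [set k : 'I_n | (k != j) && conflict I j k].
have cardK : (#|K| <= D)%N.
  by rewrite /D /max_conflicts (bigD1 j) //= leq_max leqnn.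
pose f d := [pick a in assigned st d | conflict I a j].
have fP d : d \in low :\: critical st ->
    exists a, [/\ f d = Some a, a \in assigned st d & a \in K].
  rewrite !inE => /andP[dC dl]; have := none d.
  rewrite /eligible dl dC /= negb_forall => /existsP[a].
  rewrite negb_imply negbK => /andP[aS aj].
  rewrite /f; case: pickP => [b /andP[bS bj]|/(_ a)]; last by rewrite aS aj.
  exists b; split=> //; rewrite inE conflict_sym bj andbT.
  by apply: contra jP => /eqP bj'; apply/cov; exists d; rewrite -bj'.
have finj : {in low :\: critical st &, injective f}.
  move=> d k /fP[a [-> ad _]] /fP[b [-> bk _]] [ab].
  by apply: (dS _ _ a) => //; rewrite ab.
have : (#|low :\: critical st| <= D)%N.
  rewrite -(card_in_imset finj); apply: leq_trans cardK.
  rewrite -(card_imset K (@Some_inj _)); apply/subset_leq_card/subsetP => o.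
  by case/imsetP => d /fP[a [-> _ aK] ->]; exact: imset_f.
(* The low drones number [m + D] and fewer than [m] drones are critical, so more than [D] low drones
   are noncritical. *)
rewrite leqNgt => /negP; apply.
rewrite -(ltn_add2l #|critical st|); apply: (@leq_trans (m + D)).
  by rewrite ltn_add2r.
rewrite -cardlow -(cardsID (critical st) low) leq_add2r.
by apply: subset_leq_card; apply: subsetIr.
Qed.

(** Induction on the run: [exists_eligible] refutes the stuck rule, and [s1] collects the jobs
    placed before the loop ends. *)
Lemma greedy_outcome (R : realType) (m n : nat) (I : mdsp R m n)
    (s : seq 'I_n) (st : state I) (o : option (state I)) (P : {set 'I_n}) :
  greedy s st o -> greedy_inv P st -> uniq s -> {in s, forall x, x \notin P} ->
  exists st' s1 s2,
    [/\ o = Some st', s = s1 ++ s2, greedy_inv (P :|: [set x in s1]) st'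
      & s2 = [::] \/ #|critical st'| = m].
Proof.
move=> gr; elim: gr P => {s st o} [st|j s st le|j s st i o lt el _ IH|j s st lt stuck] P inv.
- move=> _ _; exists st, [::], [::]; split=> //; last by left.
  by rewrite set_nil setU0.
- move=> _ _; exists st, [::], (j :: s); split=> //.
    by rewrite set_nil setU0.
  (* The stopping test gives only one inequality; [inv_card] supplies the other. *)
  by right; apply/eqP; rewrite eqn_leq le (inv_card inv).
- move=> /= /andP[js us] sP.
  have jP : j \notin P by apply: sP; rewrite mem_head.
  have inv' := greedy_inv_place inv jP lt el.
  have [|st' [s1 [s2 [-> -> inv'' stop]]]] := IH _ inv' us.
    move=> x xs; rewrite !inE negb_or sP ?inE ?xs ?orbT // andbT.
    by apply: contraNneq js => <-.
  exists st', (j :: s1), s2; split=> //.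
  by rewrite set_cons setUCA setUA.
- move=> _ sP; have jP : j \notin P by apply: sP; rewrite mem_head.
  have [i el] := exists_eligible inv jP lt.
  by rewrite (negPf (stuck i)) in el.
Qed.

Lemma exists_greedy (R : realType) (m n : nat) (I : mdsp R m n)
    (s : seq 'I_n) (st : state I) :
  exists o, greedy s st o.
Proof.
elim: s st => [|j s IH] st; first by exists (Some st); exact: greedy_nil.
case: (leqP m #|critical st|) => [le|lt].
  by exists (Some st); exact: greedy_stop.
case: (boolP [exists i, eligible st j i]) => [/existsP[i el]|].
  by have [o gr] := IH (place st j i); exists o; exact: greedy_place el gr.
rewrite negb_exists => /forallP none.
by exists None; exact: greedy_stuck.
Qed.

(** * The fractional knapsack bound on [OPT] *)

(** An exchange argument: after cancelling [A :&: X], the jobs of [X :\: A] earn at most [delta] per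
    unit of cost and those of [A :\: X] at least [delta], while [X :\: A] weighs no more. Products
    instead of quotients let jobs of cost 0 obey the same inequalities. *)
Lemma threshold_optimal (R : realType) (m n : nat) (I : mdsp R m n)
    (A X : {set 'I_n}) (delta : R) :
  0 <= delta -> weight I X <= weight I A ->
  (forall a, a \in A -> delta * cost I a <= reward I a) ->
  (forall b, b \notin A -> reward I b <= delta * cost I b) ->
  profit I X <= profit I A.
Proof.
move=> delta0; rewrite /weight /profit.
rewrite (big_setID A) [leRHS](big_setID X) [A :&: X]setIC /= lerD2l => WXA inA outA.
rewrite (big_setID A) [leRHS](big_setID X) [A :&: X]setIC /= lerD2l.
apply: (@le_trans _ _ (delta * \sum_(j in X :\: A) cost I j)).
  by rewrite mulr_sumr; apply: ler_sum => j; rewrite inE => /andP[jA _]; exact: outA.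
apply: (@le_trans _ _ (delta * \sum_(j in A :\: X) cost I j)).
  exact: ler_wpM2l.
by rewrite mulr_sumr; apply: ler_sum => j; rewrite inE => /andP[_ jA]; exact: inA.
Qed.

(* The density of the first job after the prefix is a threshold separating
   the prefix from the remaining jobs.  It is finite, since otherwise the
   whole prefix would have weight 0. *)
Lemma density_prefix_optimal (R : realType) (m n : nat) (I : mdsp R m n)
    (s1 s2 : seq 'I_n) (X : {set 'I_n}) :
  density_order I (s1 ++ s2) -> weight I X < weight I [set x in s1] ->
  profit I X <= profit I [set x in s1].
Proof.
case=> perm srt WX.
have mem_s x : x \in s1 ++ s2 by rewrite (perm_mem perm) mem_enum.
case: s2 perm srt mem_s => [|j s2] perm srt mem_s.
  apply: ler_sum_subset; first exact: reward_ge0.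
  by apply/subsetP => x _; rewrite inE; have := mem_s x; rewrite cats0.
have tr : transitive (fun a b => (density I b <= density I a)%E).
  by move=> b a c ab bc; exact: le_trans bc ab.
move: srt; rewrite sorted_pairwise // pairwise_cat => /and3P[/allrelP s12 _].
rewrite pairwise_cons => /andP[/allP js2 _].
have ge1 a : a \in s1 -> (density I j <= density I a)%E.
  by move=> as1; apply: s12; rewrite ?mem_head.
have le2 b : b \notin s1 -> (density I b <= density I j)%E.
  move=> bs1; have := mem_s b; rewrite mem_cat (negPf bs1) /= inE => /orP[/eqP->//|].
  exact: js2.
case: (eqVneq (cost I j) 0) => cj.
  suff W0 : weight I [set x in s1] = 0.
    by move: WX; rewrite W0 ltNge sumr_ge0// => i _; exact: cost_ge0.
  apply: big1 => a; rewrite inE => /ge1; rewrite /density cj eqxx.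
  by case: eqP => // _; rewrite leye_eq.
have cpos i : cost I i != 0 -> 0 < cost I i by rewrite lt_def cost_ge0 andbT.
apply: (@threshold_optimal _ _ _ _ _ _ (reward I j / cost I j)).
- by rewrite divr_ge0 ?reward_ge0 ?cost_ge0.
- exact: ltW.
- move=> a; rewrite inE => /ge1; rewrite /density (negPf cj).
  case: (eqVneq (cost I a) 0) => [->|ca]; first by rewrite mulr0 reward_ge0.
  by rewrite lee_fin ler_pdivlMr // cpos.
- move=> b; rewrite inE => /le2; rewrite /density (negPf cj).
  (* A job of cost 0 has infinite density, which cannot lie below the finite threshold. *)
  case: (eqVneq (cost I b) 0) => [->|cb]; first by rewrite leye_eq.
  by rewrite lee_fin ler_pdivrMr // cpos.
Qed.

(** A solution is relaxed to the union of its assignments, a single set of weight at most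
    [battery I *+ m]. Either the prefix contains every job, or its [m] critical assignments each
    exceed one battery and it outweighs that union. *)
Lemma OPT_le_prefix (R : realType) (m n : nat) (I : mdsp R m n)
    (s1 s2 : seq 'I_n) (st : state I) :
  density_order I (s1 ++ s2) -> greedy_inv [set x in s1] st ->
  s2 = [::] \/ #|critical st| = m -> OPT I <= profit I [set x in s1].
Proof.
move=> ord inv stop.
apply: bigmax_le => [|S /andP[disjS /forallP feasS]].
  by apply: sumr_ge0 => *; exact: reward_ge0.
have dS i k x : x \in S i -> x \in S k -> i = k.
  move=> xi xk; apply/eqP; apply: contraTT xk => ik.
  have /forallP/(_ i)/forallP/(_ k)/implyP/(_ ik) := disjS.
  by move=> /disjointFr -> //.
(* The strict comparison of weights below needs at least one critical drone, so [m = 0] is settled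
   apart. *)
case: (posnP m) => [m0|mpos].
  rewrite /total_profit big1 => [|i _]; last by case: i => i /= lt; exfalso; lia.
  by apply: sumr_ge0 => *; exact: reward_ge0.
rewrite /total_profit -(sum_disjoint_bigcup predT) //.
case: stop => [s2E|Cm].
  apply: ler_sum_subset; first exact: reward_ge0.
  case: ord => perm _; apply/subsetP => x _; rewrite inE.
  by rewrite -[s1]cats0 -s2E (perm_mem perm) mem_enum.
apply: (density_prefix_optimal ord).
apply: (@le_lt_trans _ _ (battery I *+ m)).
  have <- : \sum_(i < m) battery I = battery I *+ m by rewrite sumr_const card_ord.
  rewrite /weight (sum_disjoint_bigcup predT) //.
  by apply: ler_sum => i _; have /andP[] := feasS i.
apply: (@lt_le_trans _ _ (weight I (\bigcup_(i in critical st) assigned st i))); last first.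
  apply: ler_sum_subset; first exact: cost_ge0.
  by apply/bigcupsP => i _; apply/subsetP => x xi; apply/(inv_cover inv); exists i.
rewrite /weight (sum_disjoint_bigcup (mem (critical st))); last exact: (inv_disjoint inv).
have <- : \sum_(i in critical st) battery I = battery I *+ m.
  by rewrite sumr_const Cm.
apply: ltr_sum.
  have /card_gt0P[i iC] : (0 < #|critical st|)%N by rewrite Cm.
  by apply/hasP; exists i; rewrite ?mem_index_enum.
by move=> i /(inv_critical inv)[l []].
Qed.

(** * Splitting the critical assignments *)

(** The last job fits a battery alone, and the rest fitted before it was added. The comparison of
    profits only decides which part stays. *)
Lemma split_criticalP (R : realType) (m n : nat) (I : mdsp R m n)
    (P : {set 'I_n}) (st : state I) (i : 'I_(num_drones I)) :
  greedy_inv P st -> i \in critical st ->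
  [/\ (split_critical st i).1 :|: (split_critical st i).2 = assigned st i,
      [disjoint (split_critical st i).1 & (split_critical st i).2],
      feasible I (split_critical st i).1
    & feasible I (split_critical st i).2].
Proof.
move=> inv /(inv_critical inv)[l [Ll lS _ fl]]; rewrite /split_critical Ll.
have fL : feasible I [set l] by rewrite /feasible /weight big_set1 cost_le_battery.
have dL : [disjoint [set l] & assigned st i :\ l].
  by rewrite -setI_eq0; apply/eqP/setP => x; rewrite !inE; case: eqP.
by case: ifP => _; split; rewrite /= ?setD1K // 1?setUC ?setD1K // disjoint_sym.
Qed.

(** In the moved case the position of [c] in [e] determines [d], so two drones receiving a part from
    the same [c] coincide. *)
Variant correction_spec (R : realType) (m n : nat) (I : mdsp R m n)
    (st : state I) (e : seq 'I_(num_drones I)) (d : 'I_(num_drones I)) :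
    {set 'I_n} -> Prop :=
| CorrectionKept of d \in critical st :
    correction_spec st e d (split_critical st d).1
| CorrectionMoved c of c \in critical st & d \notin critical st
    & d = (m + max_conflicts I + index c e)%N :> nat :
    correction_spec st e d (split_critical st c).2
| CorrectionUnchanged of d \notin critical st :
    correction_spec st e d (assigned st d).

Lemma correctionP (R : realType) (m n : nat) (I : mdsp R m n)
    (st : state I) (e : seq 'I_(num_drones I)) (d : 'I_(num_drones I)) :
  perm_eq e (enum (critical st)) ->
  correction_spec st e d (correction st e d).
Proof.
move=> pe; have eC x : (x \in e) = (x \in critical st).
  by rewrite (perm_mem pe) mem_enum.
rewrite /correction ffunE eC; case: ifPn => [|dC]; first exact: CorrectionKept.
case: ifP => [/andP[le lt]|_]; last exact: CorrectionUnchanged.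
apply: CorrectionMoved => //; first by rewrite -eC mem_nth.
by rewrite index_uniq ?(perm_uniq pe) ?enum_uniq // subnKC.
Qed.

Lemma in_correction (R : realType) (m n : nat) (I : mdsp R m n)
    (P : {set 'I_n}) (st : state I) (e : seq 'I_(num_drones I)) (x : 'I_n) :
  greedy_inv P st -> perm_eq e (enum (critical st)) -> x \in P ->
  exists d, x \in correction st e d.
Proof.
move=> inv pe /(inv_cover inv)[d xd].
have eC y : (y \in e) = (y \in critical st).
  by rewrite (perm_mem pe) mem_enum.
have dlt := inv_range inv xd.
case: (boolP (d \in critical st)) => [dC|dC]; last first.
  by exists d; rewrite /correction ffunE eC (negPf dC) leqNgt dlt.
have [spl _ _ _] := split_criticalP inv dC.
move: (xd); rewrite -spl inE => /orP[x1|x2].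
  by exists d; rewrite /correction ffunE eC dC.
have ilt : (index d e < size e)%N by rewrite index_mem eC.
have sz : (size e <= m)%N by rewrite (perm_size pe) -cardE (inv_card inv).
(* At most [m] drones are critical, so the [m] extra drones suffice for the moved parts. *)
have lt : (m + max_conflicts I + index d e < num_drones I)%N.
  by move: (index d e) (size e) ilt sz => k l; rewrite /num_drones; lia.
exists (Ordinal lt); rewrite /correction ffunE eC /= leq_addr addKn ilt /=.
(* A critical drone holds a job and thus lies below [m + max_conflicts I], so the new drone is not
   critical. *)
case: ifPn => [/(inv_critical inv)[l [_ /(inv_range inv)]]|_].
  by rewrite /= ltnNge leq_addr.
by rewrite nth_index ?eC.
Qed.

(** Every corrected assignment is contained in one original assignment. A common job therefore
    traces [d] and [d'] to the same original drone, whose two parts are disjoint. *)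
Lemma correction_disjoint (R : realType) (m n : nat) (I : mdsp R m n)
    (P : {set 'I_n}) (st : state I) (e : seq 'I_(num_drones I))
    (d d' : 'I_(num_drones I)) (x : 'I_n) :
  greedy_inv P st -> perm_eq e (enum (critical st)) ->
  x \in correction st e d -> x \in correction st e d' -> d = d'.
Proof.
move=> inv pe.
have s1 c : c \in critical st -> x \in (split_critical st c).1 -> x \in assigned st c.
  by move=> /(split_criticalP inv)[<- _ _ _]; rewrite inE => ->.
have s2 c : c \in critical st -> x \in (split_critical st c).2 -> x \in assigned st c.
  by move=> /(split_criticalP inv)[<- _ _ _]; rewrite inE orbC => ->.
have s12 c : c \in critical st -> x \in (split_critical st c).1 ->
    x \in (split_critical st c).2 -> False.
  by move=> /(split_criticalP inv)[_ /disjointFr dj _ _] /dj ->.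
have dj := @inv_disjoint _ _ _ _ _ _ inv.
case: (correctionP d pe) => [dC|c cC dC dE|dC];
  case: (correctionP d' pe) => [dC'|c' cC' dC' dE'|dC'] xd xd'.
- exact: dj (s1 _ dC xd) (s1 _ dC' xd').
- have cd := dj _ _ _ (s1 _ dC xd) (s2 _ cC' xd').
  by move: xd'; rewrite -cd => /(s12 _ dC xd).
- exact: dj (s1 _ dC xd) xd'.
- have cd := dj _ _ _ (s1 _ dC' xd') (s2 _ cC xd).
  by move: xd; rewrite -cd => /(s12 _ dC' xd').
- have cc := dj _ _ _ (s2 _ cC xd) (s2 _ cC' xd').
  by apply: val_inj; rewrite /= dE dE' cc.
- have cd := dj _ _ _ (s2 _ cC xd) xd'.
  by rewrite -cd cC in dC'.
- exact: dj xd (s1 _ dC' xd').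
- have cd := dj _ _ _ (s2 _ cC' xd') xd.
  by rewrite -cd cC' in dC.
- exact: dj xd xd'.
Qed.

Lemma correction_valid (R : realType) (m n : nat) (I : mdsp R m n)
    (P : {set 'I_n}) (st : state I) (e : seq 'I_(num_drones I))
    (d : 'I_(num_drones I)) :
  greedy_inv P st -> perm_eq e (enum (critical st)) ->
  compatible I (correction st e d) && feasible I (correction st e d).
Proof.
move=> inv pe; have comp := inv_compatible inv.
case: (correctionP d pe) => [dC|c cC _ _|dC].
- have [spl _ -> _] := split_criticalP inv dC.
  by rewrite andbT (compatible_sub _ (comp d)) // -spl subsetUl.
- have [spl _ _ ->] := split_criticalP inv cC.
  by rewrite andbT (compatible_sub _ (comp c)) // -spl subsetUr.
- by rewrite comp (inv_feasible inv dC).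
Qed.

(** * Selecting the most profitable assignments *)

Lemma exists_best_of (R : realType) (m n : nat) (I : mdsp R m n)
    (S : {ffun 'I_(num_drones I) -> {set 'I_n}}) :
  exists T, best_of S T.
Proof.
pose r (a b : 'I_(num_drones I)) := profit I (S b) <= profit I (S a).
pose s := sort r (enum 'I_(num_drones I)).
have szs : size s = num_drones I by rewrite size_sort size_enum_ord.
have us : uniq s by rewrite sort_uniq enum_uniq.
have tot : total r by move=> a b; exact: le_total.
have tr : transitive r by move=> b a c ab bc; exact: le_trans bc ab.
have rr : reflexive r by move=> a; exact: lexx.
have le : (m <= num_drones I)%N by rewrite /num_drones; lia.
pose f (i : 'I_m) := nth (widen_ord le i) s i.
exists [ffun i => S (f i)], f; split.
- move=> i k; rewrite /f (set_nth_default (widen_ord le k)); last first.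
    by rewrite szs (leq_trans (ltn_ord i)).
  move/eqP; rewrite nth_uniq ?szs ?(leq_trans (ltn_ord _)) // => /eqP.
  exact: val_inj.
- by move=> i; rewrite ffunE.
- move=> i d nf; have ds : d \in s by rewrite mem_sort mem_enum.
  have dlt : (index d s < num_drones I)%N by rewrite -[ltnRHS]szs index_mem.
  rewrite -[X in S X](nth_index (widen_ord le i) ds).
  have : r (f i) (nth (widen_ord le i) s (index d s)); last by [].
  apply: (sorted_leq_nth tr rr _ (sort_sorted tot _)); rewrite ?inE ?szs //.
    exact: leq_trans (ltn_ord i) le.
  (* A drone of rank below [m] in the sorted list would be selected, so [d] has rank at least
     [m]. *)
  apply: leq_trans (ltnW (ltn_ord i)) _; rewrite leqNgt; apply/negP => dm.
  by have /eqP := nf (Ordinal dm); rewrite /f /= nth_index.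
Qed.

Lemma exists_density_order (R : realType) (m n : nat) (I : mdsp R m n) :
  exists s, density_order I s.
Proof.
exists (sort (fun a b => (density I b <= density I a)%E) (enum 'I_n)); split.
  by rewrite perm_sort.
by apply: sort_sorted => a b; exact: le_total.
Qed.

(* Any unselected assignment is at most the mean of the [m] selected ones, and
   at most [m + max_conflicts I <= 2 * m] are unselected. *)
Lemma best_of_third (R : realType) (m n : nat) (I : mdsp R m n)
    (S : {ffun 'I_(num_drones I) -> {set 'I_n}})
    (T : {ffun 'I_m -> {set 'I_n}}) :
  (max_conflicts I <= m)%N -> best_of S T ->
  total_profit I S <= 3 * total_profit I T.
Proof.
move=> Dm [f [finj TE best]].
(* For [m = 0] the hypothesis forces [max_conflicts I = 0], so there are no drones and both sums are
   empty. *)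
case: (posnP m) => [m0|mpos].
  rewrite /total_profit !big1 ?mulr0 // => -[d lt]; exfalso; first by lia.
  by move: lt Dm; rewrite /num_drones; lia.
have mR : 0 < m%:R :> R by rewrite ltr0n.
set top := total_profit I T.
have top0 : 0 <= top by do 2!(apply: sumr_ge0 => ? _); exact: reward_ge0.
pose F := f @: [set: 'I_m].
have topE : top = \sum_(d in F) profit I (S d).
  rewrite big_imset /=; last by move=> ? ? _ _; exact: finj.
  by rewrite /top /total_profit; apply: eq_big => [i|i _]; rewrite ?inE ?TE.
have cardF : #|F| = m by rewrite card_imset // cardsT card_ord.
have mean d : d \notin F -> profit I (S d) <= top / m%:R.
  move=> dF; rewrite ler_pdivlMr // mulr_natr.
  have <- : \sum_(i < m) profit I (S d) = profit I (S d) *+ m.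
    by rewrite sumr_const card_ord.
  apply: ler_sum => i _; rewrite TE; apply: best => l.
  by apply: contraNneq dF => <-; rewrite imset_f.
have out : \sum_(d in ~: F) profit I (S d) <= 2 * top.
  apply: (@le_trans _ _ (\sum_(d in ~: F) top / m%:R)).
    by apply: ler_sum => d; rewrite inE; exact: mean.
  have -> : 2 * top = top / m%:R *+ (2 * m).
    by rewrite -[RHS]mulr_natr natrM mulrCA divfK // gt_eqF.
  rewrite sumr_const; apply: ler_wpMn2l; first by rewrite divr_ge0 ?ler0n.
  by move: (cardsC F); rewrite cardF card_ord /num_drones; lia.
rewrite /total_profit (bigID (mem F)) /= -topE.
have -> : \sum_(d | d \notin F) profit I (S d) = \sum_(d in ~: F) profit I (S d).
  by apply: eq_bigl => d; rewrite inE.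
lra.
Qed.

(** * Existence of a run, and the guarantee for every run *)

Theorem theorem5 (R : realType) (m n : nat) (I : mdsp R m n)
    (Delta_le_m : (max_conflicts I <= m)%N) :
  (exists o, mga I o) /\
  (forall o, mga I o ->
     exists T : {ffun 'I_m -> {set 'I_n}},
       [/\ o = Some T,
           pairwise_disjoint T,
           forall i, compatible I (T i) && feasible I (T i)
         & 3^-1 * OPT I <= total_profit I T]).
Proof.
split.
  have [s ord] := exists_density_order I.
  have [[st|] gr] := exists_greedy s (init_state I); last first.
    by exists None; exact: mga_stuck gr.
  have [T best] := exists_best_of (correction st (enum (critical st))).
  by exists (Some T); exact: mga_output ord gr (perm_refl _) best.
have outcome s o : density_order I s -> greedy s (init_state I) o ->
    exists st s1 s2, [/\ o = Some st, s = s1 ++ s2,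
      greedy_inv [set x in s1] st & s2 = [::] \/ #|critical st| = m].
  move=> [perm _] gr.
  have us : uniq s by rewrite (perm_uniq perm) enum_uniq.
  have [|st [s1 [s2 [oE sE inv stop]]]] :=
    greedy_outcome gr (greedy_inv_init I) us.
    by move=> x _; rewrite inE.
  by exists st, s1, s2; split; rewrite // -[X in greedy_inv X]set0U.
(* By [outcome] the loop always ends in some state, which rules out a stuck run. *)
move=> _ [s ord /(outcome _ _ ord)[? [? [? []]]]//|s st e T ord gr pe best].
have [_ [s1 [s2 [[<-] sE inv stop]]]] := outcome _ _ ord gr.
have [f [finj TE _]] := best.
exists T; split=> //.
- apply/forallP => i; apply/forallP => k; apply/implyP; apply: contraNT.
  rewrite -setI_eq0 => /set0Pn[x]; rewrite inE !TE => /andP[xi xk].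
  exact/eqP/finj/(correction_disjoint inv pe xi xk).
- by move=> i; rewrite TE; exact: correction_valid inv pe.
(* The chain is: [OPT I] is at most the profit of the prefix, which is at most the total after
   correction, which is at most three times that of [T]. *)
- rewrite sE in ord.
  have opt := OPT_le_prefix ord inv stop.
  have cov : profit I [set x in s1] <= total_profit I (correction st e).
    by apply: profit_le_cover => x; exact: in_correction inv pe.
  have := best_of_third Delta_le_m best; lra.
Qed.
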